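(* Let $n\ge 2$, $p\in(0,1)$, $t\in\{2,\ldots,n\}$ and $k\in\{1,\ldots,n\}$. Let $\overline{P}(n,k,p,t)$ be the tightest upper bound on the probability that $n$ identical $t$-wise independent Bernoulli random variables with success probability $p$ add up to at least $k$. Then $\overline{P}(n,k,p,t)$ equals the optimal value of the linear program in the $n+1$ decision variables $v_0,\ldots,v_n$: $$\begin{array}{rll}\max & \displaystyle\sum_{\ell=k}^n v_\ell & \\ \text{s.t.} & \displaystyle\sum_{\ell=m}^n\binom{\ell}{m}v_\ell=\binom{n}{m}p^m, & \forall m\in\{0,1,\ldots,t\},\\ & v_\ell\ge 0, & \forall \ell\in\{0,1,\ldots,n\},\end{array}$$ where $v_\ell$ represents $\mathbb{P}\left(\sum_{i=1}^n\tilde c_i=\ell\right)$.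
   Context: $\overline{P}(n,k,p,t)$ denotes the maximum of $\mathbb{P}_\theta\left(\sum_{i=1}^n\tilde c_i\ge k\right)$ over all probability distributions $\theta$ of a random vector $(\tilde c_1,\ldots,\tilde c_n)$ on $\{0,1\}^n$ such that $\mathbb{P}_\theta(\tilde c_i=1\ \forall i\in J)=p^{|J|}$ for every $J\subseteq\{1,\ldots,n\}$ with $1\le|J|\le t$ (i.e. identical $t$-wise independent Bernoulli variables with success probability $p$). *)

(* Defs.v *)
From HB Require Import structures.
From mathcomp Require Import all_boot all_order all_algebra.
From mathcomp Require Import boolp classical_sets reals.

Set Implicit Arguments.
Unset Strict Implicit.
Unset Printing Implicit Defensive.

Import Order.TTheory GRing.Theory Num.Theory.

Local Open Scope classical_set_scope.
Local Open Scope ring_scope.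

Notation bvec n := {ffun 'I_n -> bool}.

Section Distributions.
Context {R : realType} {n : nat}.

(* A probability distribution on {0,1}^n, given by its mass function. *)
Definition is_distribution (theta : {ffun bvec n -> R}) : Prop :=
  (forall c, 0 <= theta c) /\ \sum_c theta c = 1.

Definition prob (theta : {ffun bvec n -> R}) (A : pred (bvec n)) : R :=
  \sum_(c | A c) theta c.

Definition bsum (c : bvec n) : nat := (\sum_(i < n) c i)%N.

(* J ranges over the nonempty sets of at most t coordinates; singletons fix
   all the marginals to be Bernoulli(p). *)
Definition twise_independent (p : R) (t : nat)
    (theta : {ffun bvec n -> R}) : Prop :=
  is_distribution theta /\
  forall J : {set 'I_n}, (1 <= #|J| <= t)%N ->
    prob theta (fun c => [forall i in J, c i]) = p ^+ #|J|.

End Distributions.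

Section Optimization.
Context {R : realType}.

Definition attains_sup (A : set R) : Prop := A (sup A) /\ ubound A (sup A).

Definition tail_probs (n k : nat) (p : R) (t : nat) : set R :=
  [set x | exists theta : {ffun bvec n -> R},
     twise_independent p t theta /\ x = prob theta (fun c => (k <= bsum c)%N)].

Definition Pbar (n k : nat) (p : R) (t : nat) : R := sup (tail_probs n k p t).

Definition lp_feasible (n : nat) (p : R) (t : nat) (v : 'rV[R]_n.+1) : Prop :=
  (forall m : nat, (m <= t)%N ->
     \sum_(l < n.+1 | (m <= l)%N) 'C(l, m)%:R * v 0 l = 'C(n, m)%:R * p ^+ m)
  /\ (forall l : 'I_n.+1, 0 <= v 0 l).

Definition lp_objective (n k : nat) (v : 'rV[R]_n.+1) : R :=
  \sum_(l < n.+1 | (k <= l)%N) v 0 l.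

Definition lp_values (n k : nat) (p : R) (t : nat) : set R :=
  [set lp_objective k v | v in lp_feasible (n := n) p t].

Definition lp_opt (n k : nat) (p : R) (t : nat) : R := sup (lp_values n k p t).

End Optimization.

(* Main.v *)
Require Import Defs.
From HB Require Import structures.
From mathcomp Require Import all_boot all_order all_algebra.
From mathcomp Require Import boolp classical_sets reals.
From mathcomp Require Import topology normedtype derive.
From mathcomp Require Import ring zify.

(** A vector v is feasible for the linear program if and only if it is the law of
the sum of identical t-wise independent variables ([lp_feasibleP]). Both
directions of this equivalence rest on the m-th binomial moment of the number of
successes S. Since 'C(S, m) counts the sets J of m coordinates on which all
variables equal 1, the moment E['C(S, m)] is the sum over these J of
P(c_i = 1 on J) ([binomial_moment]). If the variables are t-wise independent,
every term is p ^ m for m <= t, so the law of S is feasible for the linear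
program ([twise_independent_lp_feasible]).

Conversely, a feasible v is realized by spreading the mass v_l uniformly over
the 'C(n, l) vectors with l ones ([spread]). Under this exchangeable
distribution P(c_i = 1 on J) depends only on m = #|J|; it equals the sum over l
of 'C(n - m, n - l) / 'C(n, l) * v_l, and since
'C(n, m) * 'C(n - m, n - l) = 'C(n, l) * 'C(l, m), the m-th constraint of the
program says exactly that this is p ^ m ([spread_twise_independent]).

Hence the attainable tail probabilities and the values of the linear program
form the same set of reals ([tail_probs_lp_values]). The feasible region is
nonempty, as it contains the law of S for n independent variables, and compact:
the constraint m = 0 places it in the unit cube. The continuous objective
therefore has a maximum on it ([lp_values_attained]). *)

Set Implicit Arguments.
Unset Strict Implicit.
Unset Printing Implicit Defensive.

Import Order.TTheory GRing.Theory Num.Theory.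
Import numFieldNormedType.Exports.

Local Open Scope ring_scope.

(** * Counting 0/1 vectors *)

Lemma bsum_card n (c : bvec n) : bsum c = #|[set i | c i]|.
Proof.
rewrite /bsum -sum1_card [RHS]big_mkcond /=; apply: eq_bigr => i _.
by rewrite inE; case: (c i).
Qed.

Lemma bsum_le n (c : bvec n) : (bsum c <= n)%N.
Proof. by rewrite bsum_card -[leqRHS]card_ord max_card. Qed.

Lemma forall_in_subset n (c : bvec n) (J : {set 'I_n}) :
  [forall i in J, c i] = (J \subset [set i | c i]).
Proof.
by apply/forall_inP/fintype.subsetP => cJ i /cJ; rewrite inE.
Qed.

(** Complementation maps the supersets of [J] with [l] elements onto the subsets
of [~: J] with [#|T| - l] elements. Both sides vanish when [l < #|J|]. *)
Lemma card_superset_draws (T : finType) (J : {set T}) l : (l <= #|T|)%N ->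
  #|[set A : {set T} | J \subset A & #|A| == l]| = 'C(#|T| - #|J|, #|T| - l).
Proof.
move=> lT.
rewrite -(cardsC J) addKn -cards_draws -[RHS](card_imset _ (@finset.setC_inj T)).
apply: eq_card => A; rewrite (can_imset_pre _ (@finset.setCK T)) !inE finset.setCS.
congr andb; rewrite [in RHS]cardsCs finset.setCK (cardsC J).
by rewrite eqn_sub2lE ?max_card.
Qed.

Lemma card_bvec_draws n (J : {set 'I_n}) l : (l <= n)%N ->
  #|[pred c : bvec n | [forall i in J, c i] && (bsum c == l)]| =
    'C(n - #|J|, n - l).
Proof.
move=> ln; have := @card_superset_draws 'I_n J l; rewrite card_ord => <- //.
pose f (c : bvec n) : {set 'I_n} := [set i | c i].
pose g (A : {set 'I_n}) : bvec n := [ffun i => i \in A].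
have fK : cancel f g by move=> c; apply/ffunP => i; rewrite ffunE inE.
have gK : cancel g f by move=> A; apply/setP => i; rewrite inE ffunE.
rewrite -(card_imset _ (can_inj fK)); apply: eq_card => A.
by rewrite (can2_imset_pre _ fK gK) !inE forall_in_subset bsum_card -/(f _) gK.
Qed.

Lemma bin_mul_bin n m l : (m <= n)%N -> (l <= n)%N ->
  ('C(n, m) * 'C(n - m, n - l) = 'C(n, l) * 'C(l, m))%N.
Proof.
move=> mn ln; have [ml|lm] := leqP m l; last first.
  by rewrite (bin_small lm) (@bin_small (n - m)) ?muln0// ltn_sub2lE.
apply/eqP; rewrite -(eqn_pmul2r (fact_gt0 m)) -(eqn_pmul2r (fact_gt0 (l - m))).
rewrite -(eqn_pmul2r (fact_gt0 (n - l))).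
have lmE : (n - m - (n - l) = l - m)%N by lia.
have h1 := bin_fact mn; have h2 := bin_fact ln; have h3 := bin_fact ml.
have h4 : ('C(n - m, n - l) * ((n - l)`! * (l - m)`!) = (n - m)`!)%N.
  by rewrite -lmE bin_fact// leq_sub2l.
apply/eqP; transitivity n`!.
  by rewrite -h1 -h4; ring.
by rewrite -h2 -h3; ring.
Qed.

(** * Moments of the number of successes *)

Section Moments.
Variables (R : realType) (n : nat).
Implicit Types (theta : {ffun bvec n -> R}) (v : 'rV[R]_n.+1).

(** The expectation of [f] of the number of successes, computed from its law. *)
Lemma sum_prob_bsum theta (f : nat -> R) :
  \sum_(l < n.+1) f l * prob theta (fun c => bsum c == l) =
  \sum_c f (bsum c) * theta c.
Proof.
rewrite [RHS](partition_big (fun c => inord (bsum c) : 'I_n.+1) predT)//=.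
apply: eq_bigr => l _; rewrite /prob mulr_sumr; apply: eq_big => c.
  by rewrite -val_eqE /= inordK// ltnS bsum_le.
by move=> /eqP->.
Qed.

Lemma prob_tail theta k :
  \sum_(l < n.+1 | (k <= l)%N) prob theta (fun c => bsum c == l) =
  prob theta (fun c => (k <= bsum c)%N).
Proof.
rewrite /prob [RHS]big_mkcond -/(prob _ _).
rewrite (eq_bigr (fun c => (k <= bsum c)%N%:R * theta c)); last first.
  by move=> c _; case: ifP => _; rewrite ?mul1r ?mul0r.
rewrite -(sum_prob_bsum theta (fun l => (k <= l)%N%:R)) big_mkcond.
by apply: eq_bigr => l _; case: ifP => _; rewrite ?mul1r ?mul0r.
Qed.

(** ['C(bsum c, m)] counts the [m]-sets of coordinates on which [c] is 1. *)
Lemma binomial_moment theta m :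
  \sum_(l < n.+1 | (m <= l)%N) 'C(l, m)%:R * prob theta (fun c => bsum c == l) =
  \sum_(J : {set 'I_n} | #|J| == m) prob theta (fun c => [forall i in J, c i]).
Proof.
rewrite big_mkcond (eq_bigr (fun l : 'I_n.+1 =>
  'C(l, m)%:R * prob theta (fun c => bsum c == l))); last first.
  by move=> l _; case: leqP => // lm; rewrite bin_small// mul0r.
rewrite (sum_prob_bsum theta (fun l => 'C(l, m)%:R)).
rewrite /prob (exchange_big_dep predT)//=; apply: eq_bigr => c _.
rewrite sumr_const mulr_natl bsum_card -cards_draws; congr (_ *+ _).
by apply: eq_card => J; rewrite !inE andbC; congr andb; rewrite forall_in_subset.
Qed.

Lemma twise_independent_lp_feasible (p : R) t theta v :
    twise_independent p t theta ->
    (forall l : 'I_n.+1, v 0 l = prob theta (fun c => bsum c == l)) ->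
  lp_feasible p t v.
Proof.
move=> [[theta_ge0 theta1] theta_ind] vE; split=> [m mt|l]; last first.
  by rewrite vE; apply: sumr_ge0.
under eq_bigr do rewrite vE.
rewrite binomial_moment (eq_bigr (fun=> p ^+ m)); last first.
  (* Independence is assumed for nonempty [J] only; for [J] empty the event is
     certain, and the total mass 1 is p ^ 0. *)
  move=> J /eqP Jm; have [m0|m_gt0] := posnP m; last first.
    by rewrite theta_ind Jm// m_gt0.
  rewrite m0 expr0 -theta1; apply: eq_bigl => c.
  have /eqP -> : J == finset.set0 by rewrite -cards_eq0 Jm m0.
  by apply/forall_inP => i; rewrite inE.
rewrite sumr_const mulr_natl; congr (_ *+ _).
by rewrite -[X in 'C(X, _)]card_ord -card_draws; apply: eq_card => J; rewrite !inE.
Qed.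

(** * The exchangeable distribution with a given law of the sum *)

(** The distribution that gives the vectors with [l] ones total mass [v 0 l],
shared equally among them; a probability distribution when [v] is one. The cast
[inord] loses nothing here, since [bsum c <= n]. *)
Definition spread v : {ffun bvec n -> R} :=
  [ffun c => v 0 (inord (bsum c)) / 'C(n, bsum c)%:R].

Lemma prob_spread v (J : {set 'I_n}) (l : 'I_n.+1) :
  prob (spread v) (fun c => [forall i in J, c i] && (bsum c == l)) =
  'C(n - #|J|, n - l)%:R * (v 0 l / 'C(n, l)%:R).
Proof.
rewrite /prob (eq_bigr (fun=> v 0 l / 'C(n, l)%:R)); last first.
  by move=> c /andP[_ /eqP cl]; rewrite ffunE cl inord_val.
rewrite sumr_const mulr_natl; congr (_ *+ _).
by rewrite -card_bvec_draws ?leq_ord//; apply: eq_card.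
Qed.

Lemma bin_neq0 (l : 'I_n.+1) : 'C(n, l)%:R != 0 :> R.
Proof. by rewrite pnatr_eq0 -lt0n bin_gt0 leq_ord. Qed.

Lemma prob_spread_bsum v (l : 'I_n.+1) :
  prob (spread v) (fun c => bsum c == l) = v 0 l.
Proof.
transitivity (prob (spread v)
    (fun c => [forall i in finset.set0, c i] && (bsum c == l))).
  apply: eq_bigl => c; rewrite (_ : [forall i in _, _] = true)//.
  by apply/forall_inP => i; rewrite inE.
rewrite prob_spread cards0 subn0 bin_sub ?leq_ord//.
by rewrite mulrC divfK// bin_neq0.
Qed.

(** The exchangeable distribution gives all [#|J|]-sets the same probability, so
the binomial moment is ['C(n, #|J|)] times that of [J]. *)
Lemma bin_prob_spread v (J : {set 'I_n}) :
  'C(n, #|J|)%:R * prob (spread v) (fun c => [forall i in J, c i]) =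
  \sum_(l < n.+1 | (#|J| <= l)%N) 'C(l, #|J|)%:R * v 0 l.
Proof.
have Jn : (#|J| <= n)%N by rewrite -[leqRHS]card_ord max_card.
rewrite /prob (partition_big (fun c => inord (bsum c) : 'I_n.+1) predT)//=.
rewrite mulr_sumr [RHS]big_mkcond; apply: eq_bigr => l _.
rewrite (eq_bigl (fun c : bvec n =>
  [forall i in J, c i] && (bsum c == l))); last first.
  by move=> c; rewrite -val_eqE /= inordK// ltnS bsum_le.
rewrite -/(prob _ _) prob_spread mulrA -natrM bin_mul_bin ?leq_ord// natrM.
transitivity ('C(l, #|J|)%:R * v 0 l); first by field; exact: bin_neq0.
by case: leqP => // lJ; rewrite bin_small// mul0r.
Qed.

Lemma spread_twise_independent (p : R) t v : (t <= n)%N ->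
  lp_feasible p t v -> twise_independent p t (spread v).
Proof.
move=> tn [vP v_ge0]; split; first split.
- by move=> c; rewrite ffunE mulr_ge0// invr_ge0 ler0n.
- (* The constraint m = 0 says that the masses v_l add up to 1. *)
  have := vP 0%N (leq0n _); rewrite bin0 mul1r expr0 => <-.
  rewrite -(eq_bigr _ (fun c _ => mul1r _)) -(sum_prob_bsum _ (fun=> 1)).
  by apply: eq_bigr => l _; rewrite prob_spread_bsum bin0.
- move=> J /andP[_ Jt]; have := bin_prob_spread v J; rewrite vP//.
  by apply: mulfI; rewrite pnatr_eq0 -lt0n bin_gt0 (leq_trans Jt).
Qed.

Lemma lp_feasibleP (p : R) t v : (t <= n)%N ->
  lp_feasible p t v <->
  exists theta : {ffun bvec n -> R}, twise_independent p t theta /\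
    forall l : 'I_n.+1, v 0 l = prob theta (fun c => bsum c == l).
Proof.
move=> tn; split=> [vP|[theta [theta_ind vE]]].
  exists (spread v); split; first exact: spread_twise_independent.
  by move=> l; rewrite prob_spread_bsum.
exact: twise_independent_lp_feasible vE.
Qed.

(** * Independent variables *)

(** The product distribution of [n] independent Bernoulli([p]) variables; it has
nonnegative masses when [0 <= p <= 1]. *)
Definition iid (p : R) : {ffun bvec n -> R} :=
  [ffun c : bvec n => \prod_i (if c i then p else 1 - p)].

Lemma prob_iid (p : R) (J : {set 'I_n}) :
  prob (iid p) (fun c => [forall i in J, c i]) = p ^+ #|J|.
Proof.
(* The event is absorbed into the factors, by letting the factor of [i \in J]
   vanish at [false]; the sum over vectors then factorizes. *)
pose F (i : 'I_n) (b : bool) : R :=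
  if (i \in J) ==> b then (if b then p else 1 - p) else 0.
transitivity (\sum_(c : bvec n) \prod_i F i (c i)).
  rewrite /prob big_mkcond; apply: eq_bigr => c _; rewrite ffunE.
  case: ifP => [/forall_inP cJ|/negbT].
    by apply: eq_bigr => i _; rewrite /F; have [/cJ ->|] := boolP (i \in J).
  rewrite negb_forall_in => /exists_inP[i iJ ci].
  by rewrite (bigD1 i)//= /F iJ (negbTE ci) mul0r.
rewrite -bigA_distr_bigA -prodr_const [RHS]big_mkcond; apply: eq_bigr => i _.
rewrite big_bool /F implybT implybF.
by case: (i \in J); rewrite /= ?addr0// addrC subrK.
Qed.

Lemma iid_twise_independent (p : R) t : 0 < p < 1 -> twise_independent p t (iid p).
Proof.
move=> /andP[p_gt0 p_lt1]; split; last by move=> J _; exact: prob_iid.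
split=> [c|].
  rewrite ffunE; apply: prodr_ge0 => i _.
  by case: (c i); rewrite ?subr_ge0 ltW.
rewrite -(expr0 p) -(cards0 'I_n) -prob_iid; apply: eq_bigl => c.
by apply/esym/forall_inP => i; rewrite inE.
Qed.

End Moments.

(** * Equality and attainment of the optimal values *)

Local Open Scope classical_set_scope.

Lemma tail_probs_lp_values (R : realType) n k (p : R) t : (t <= n)%N ->
  tail_probs n k p t = lp_values n k p t.
Proof.
move=> tn; apply/seteqP; split=> [x [theta [theta_ind ->]]|x [v vP <-]].
  pose v : 'rV[R]_n.+1 := \row_l prob theta (fun c => bsum c == l).
  have vE l : v 0 l = prob theta (fun c => bsum c == l) by rewrite mxE.
  exists v; first exact: twise_independent_lp_feasible vE.
  by rewrite -prob_tail; apply: eq_bigr.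
have [theta [theta_ind vE]] := (lp_feasibleP p v tn).1 vP.
by exists theta; split=> //; rewrite -prob_tail; apply: eq_bigr.
Qed.

Lemma linear_form_continuous (R : realType) n (P : pred 'I_n) (a : 'I_n -> R) :
  continuous (fun v : 'rV[R]_n => \sum_(l | P l) a l * v 0 l).
Proof.
apply: continuous_big; first exact: add_continuous.
move=> l _ v.
exact: (continuous_comp (@coord_continuous R _ _ 0 l v) (@mulrl_continuous _ _ _)).
Qed.

Lemma lp_feasible_compact (R : realType) n (p : R) t :
  compact (@lp_feasible R n p t : set 'rV[R]_n.+1).
Proof.
have cube : compact [set v : 'rV[R]_n.+1 | forall i, v ord0 i \in `[0, 1]%R].
  by apply: (@rV_compact _ _ (fun=> `[0 : R, 1]%classic)) => _;
    exact: segment_compact.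
apply: (subclosed_compact _ cube) => [|v [vP v_ge0] i].
  rewrite (_ : @lp_feasible R n p t =
    (\bigcap_(m in [set m | (m <= t)%N])
       ((fun v : 'rV[R]_n.+1 => \sum_(l < n.+1 | (m <= l)%N) 'C(l, m)%:R * v 0 l)
          @^-1` [set 'C(n, m)%:R * p ^+ m])) `&`
    (\bigcap_(l in [set: 'I_n.+1])
       ((fun v : 'rV[R]_n.+1 => v 0 l) @^-1` [set x | 0 <= x]))); last first.
    apply/seteqP; split=> v [vP v_ge0]; split=> //.
      by move=> l _; exact: v_ge0.
    by move=> l; exact: v_ge0 l I.
  apply: (@topology_structure.closedI 'rV[R]_n.+1);
    apply: closed_bigI => i _; apply: preimage_closed.
  - by move=> ? _; exact: linear_form_continuous.
  - exact: closed_eq.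
  - by move=> ? _; exact: coord_continuous.
  - exact: closed_ge.
(* By the constraint m = 0 the nonnegative coordinates add up to 1. *)
rewrite /= in_itv /= v_ge0 /=.
have := vP 0%N (leq0n _); rewrite bin0 mul1r expr0 => <-.
by rewrite (bigD1 i)//= bin0 mul1r lerDl sumr_ge0// => j _; rewrite bin0 mul1r.
Qed.

Lemma lp_values_attained (R : realType) n k (p : R) t : 0 < p < 1 ->
  attains_sup (lp_values n k p t).
Proof.
move=> p01.
have feas0 : (@lp_feasible R n p t : set _) !=set0.
  exists (\row_l prob (iid n p) (fun c => bsum c == l)).
  apply: twise_independent_lp_feasible (iid_twise_independent n t p01) _ => l.
  by rewrite mxE.
have obj_cont : continuous (@lp_objective R n k).
  rewrite (_ : @lp_objective R n k =
      fun v => \sum_(l < n.+1 | (k <= l)%N) 1 * v 0 l).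
    exact: linear_form_continuous.
  by apply/funext => v; apply: eq_bigr => l _; rewrite mul1r.
have [v] := EVT_max_rV feas0 (@lp_feasible_compact R n p t)
  (continuous_subspaceT obj_cont).
rewrite inE => vP v_max.
have v_ub : ubound (lp_values n k p t) (lp_objective k v).
  by move=> _ [w wP <-]; apply: v_max; rewrite inE.
have v_val : lp_values n k p t (lp_objective k v) by exists v.
rewrite /attains_sup; suff -> : sup (lp_values n k p t) = lp_objective k v by split.
apply/eqP; rewrite eq_le ge_sup//=; last by exists (lp_objective k v).
by apply: ub_le_sup => //; exists (lp_objective k v).
Qed.

Theorem corollary4p2 (R : realType) (n : nat) (p : R) (t k : nat)
    (hn : (2 <= n)%N) (hp : 0 < p < 1)
    (ht : (2 <= t <= n)%N) (hk : (1 <= k <= n)%N) :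
  [/\ attains_sup (tail_probs n k p t),
      attains_sup (lp_values n k p t),
      Pbar n k p t = lp_opt n k p t
    & forall v : 'rV[R]_n.+1,
        lp_feasible p t v <->
        exists theta : {ffun bvec n -> R},
          twise_independent p t theta /\
          forall l : 'I_n.+1, v 0 l = prob theta (fun c => bsum c == l)].
Proof.
have /andP[_ tn] := ht.
rewrite /Pbar /lp_opt tail_probs_lp_values//.
split=> //; [exact: lp_values_attained | exact: lp_values_attained |].
by move=> v; exact: lp_feasibleP.
Qed.
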